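(* Let $\ell\in\mathbb{N}$. For every $\epsilon>0$ there exists an integer $r=r(\epsilon,\ell)\ge 2^\ell$ such that for every odd real polynomial $v(x)=\sum_{j=1}^{\ell}a_jx^{2j-1}$ ($a_j\in\mathbb{R}$), the set $\mathcal R(v,\epsilon)=\{n\in\mathbb{N}:\|v(n)\|<\epsilon\}$ is a $\Delta_{\ell,r}^*$ set.
   Context: $\mathbb{N}=\{1,2,\dots\}$; $\|x\|$ is the distance from $x$ to the nearest integer. Define $\partial:\bigcup_{\ell\ge1}\mathbb{Z}^{2^\ell}\to\mathbb{Z}$ recursively by $\partial(m_1,m_2)=m_2-m_1$ and $\partial(m_1,\dots,m_{2^\ell})=\partial(m_{2^{\ell-1}+1},\dots,m_{2^\ell})-\partial(m_1,\dots,m_{2^{\ell-1}})$ for $\ell>1$. For $r\ge 2^\ell$ and an $r$-element sequence $(n_k)_{k=1}^r$ in $\mathbb{Z}$, let $D_\ell((n_k)_{k=1}^r)=\{\partial(n_{j_1},\dots,n_{j_{2^\ell}}): 1\le j_1<\dots<j_{2^\ell}\le r\}$. A set $E\subseteq\mathbb{N}$ is a $\Delta_{\ell,r}$ set if $D_\ell((n_k)_{k=1}^r)\subseteq E$ for some $r$-element sequence $(n_k)_{k=1}^r$ in $\mathbb{Z}$; $E$ is $\Delta_{\ell,r}^*$ if it has non-empty intersection with every $\Delta_{\ell,r}$ set. *)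

(* Defs.v *)
From mathcomp Require Export all_boot all_order all_algebra.
From mathcomp Require Export classical_sets reals.

Set Implicit Arguments.
Unset Strict Implicit.
Unset Printing Implicit Defensive.
Import Order.TTheory GRing.Theory Num.Theory.

Local Open Scope classical_set_scope.
Local Open Scope ring_scope.

(* The positive integers, as a subset of Z, so that they can be compared with
   the sets of differences below. *)
Definition Npos : set int := [set n | 0 < n].

Definition dist_int (R : realType) (x : R) : R :=
  inf [set `|x - m%:~R| | m in [set: int]].

(* [delta l m] is meaningful for [size m = 2 ^ l] and [1 <= l]; starting the
   recursion at [l = 0] yields the usual base case, see [delta1E]. *)
Fixpoint delta (l : nat) (m : seq int) : int :=
  if l is l'.+1 then delta l' (drop (2 ^ l') m) - delta l' (take (2 ^ l') m)
  else head 0 m.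

Lemma delta1E (m1 m2 : int) : delta 1 [:: m1; m2] = m2 - m1.
Proof. by []. Qed.

(* Indices are shifted to start at 0. *)
Definition Dset (l r : nat) (n : r.-tuple int) : set int :=
  [set d | exists j : (2 ^ l).-tuple 'I_r,
     sorted ltn (map val j) /\ d = delta l (map (tnth n) j)].

(* Only used with [2 ^ l <= r]; for smaller [r], [Dset l n] is empty. *)
Definition is_Delta (l r : nat) (E : set int) : Prop :=
  E `<=` Npos /\ exists n : r.-tuple int, Dset l n `<=` E.

Definition is_Delta_star (l r : nat) (E : set int) : Prop :=
  E `<=` Npos /\ forall F : set int, is_Delta l r F -> E `&` F !=set0.

Definition return_set (R : realType) (v : {poly R}) (eps : R) : set int :=
  [set n | Npos n /\ dist_int v.[n%:~R] < eps].

(* Main.v *)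
Require Import Defs.
From mathcomp Require Import all_boot all_order all_algebra.
From mathcomp Require Import classical_sets reals.
From mathcomp Require Import zify ring lra.
Import Order.TTheory GRing.Theory Num.Theory.
Local Open Scope ring_scope.

(** The iterated difference of [m] is the sum of the [s_i m_i], where [s] is the
    Thue-Morse sequence of signs. Expand the power [(\sum_i s_i m_i) ^ d] of an
    odd exponent [d < 2 l] and colour each finite sequence of integers by the
    approximate values modulo 1 of the finitely many monomials
    [a_j x_1 ^ e_1 ... x_m ^ e_m]. Ramsey's theorem yields a subsequence of
    length [2 ^ l] along which such a monomial depends, up to a small error
    modulo 1, only on the exponents [e] and not on the indices. Collecting equal
    exponents, the coefficient of each [e] is a monomial quasi-symmetric function
    evaluated at the Thue-Morse signs, and for odd [d < 2 l] these all vanish. *)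

Set Implicit Arguments.
Unset Strict Implicit.
Unset Printing Implicit Defensive.

(** * Ramsey's theorem for subsequences of a finite sequence *)

Definition homogeneous (T : eqType) (C : Type) (k : nat) (f : seq T -> C)
    (t : seq T) : Prop :=
  forall u u', subseq u t -> subseq u' t -> size u = k -> size u' = k ->
  f u = f u'.

Lemma homogeneous_subseq (T : eqType) (C : Type) k (f : seq T -> C) t t' :
  subseq t' t -> homogeneous k f t -> homogeneous k f t'.
Proof.
move=> st h u u' su su'; apply: h; exact: subseq_trans st.
Qed.

(** Each entry carries the common colour of the subsequences of length [k.+1] that start at it. *)
Fixpoint end_homogeneous (T : eqType) (C : Type) (k : nat) (f : seq T -> C)
    (p : seq (T * C)) : Prop :=
  if p is x :: p' then
    (forall w, subseq w (map fst p') -> size w = k -> f (x.1 :: w) = x.2)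
    /\ end_homogeneous k f p'
  else True.

Lemma end_homogeneous_filter (T : eqType) (C : eqType) k (f : seq T -> C) p c :
  end_homogeneous k f p ->
  forall u, subseq u (map fst (filter (fun x => x.2 == c) p)) ->
  size u = k.+1 -> f u = c.
Proof.
elim: p => [|[x d] p IHp] /=; first by move=> _ u /eqP ->.
move=> [hx hp] u; case: eqP => [dc|_]; last exact: (IHp hp).
case: u => [//|y u] /=; case: eqP => [->|_ su]; last exact: (IHp hp (y :: u)).
move=> su [sz]; rewrite hx -?dc //.
by apply: (subseq_trans su); apply/map_subseq/filter_subseq.
Qed.

Lemma pigeonhole_seq (C : finType) (N : nat) (s : seq C) :
  (#|C| * N < size s)%N -> exists c, (N <= count_mem c s)%N.
Proof.
move=> h; apply/existsP; apply: contraLR h.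
rewrite negb_exists -leqNgt => /forallP h.
have -> : size s = (\sum_(c : C) count_mem c s)%N.
  under eq_bigr do rewrite -sum1_count.
  rewrite (exchange_big_dep predT) //= -sum1_size; apply: eq_bigr => x _.
  by rewrite (eq_bigl (pred1 x)) ?big_pred1_eq // => c; rewrite /= eq_sym.
rewrite -sum_nat_const; apply: leq_sum => c _.
by apply: ltnW; rewrite ltnNge; apply: h.
Qed.

(** Induction on [k]: the case [k], applied to the colouring of the tails that follow a fixed first
    entry, builds a long end-homogeneous sequence entry by entry. The pigeonhole principle then
    selects [N] entries carrying the same colour. *)
Lemma Ramsey_subseq (C : finType) (k N : nat) : exists r : nat,
  forall (T : eqType) (s : seq T) (f : seq T -> C), (r <= size s)%N ->
  exists t, [/\ subseq t s, size t = N & homogeneous k f t].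
Proof.
elim: k N => [|k IHk] N.
  exists N => T s f hs; exists (take N s); split.
  - exact: take_subseq.
  - exact: size_takel.
  - by move=> u u' _ _ /size0nil -> /size0nil ->.
have [r Hr] : exists r : nat, forall (T : eqType) (s : seq T) (f : seq T -> C),
    (r <= size s)%N ->
    exists p, [/\ subseq (map fst p) s, size p = (#|C| * N).+1
                & end_homogeneous k f p].
  elim: _.+1 => [|M [r0 IHM]].
    by exists 0%N => T s f _; exists [::]; rewrite sub0seq.
  have [r1 Hr1] := IHk r0.
  exists r1.+1 => T [//|x s] f /= hs.
  have [t [ts tr ht]] := Hr1 T s (fun w => f (x :: w)) hs.
  have [|p [pt pM hp]] := IHM T t f; first by rewrite tr.
  (* The colour of [x] is read off from one tail of length [k]. If [t] is shorter than that, no tail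
     [w] of length [k] exists and the value is arbitrary. *)
  exists ((x, f (x :: take k t)) :: p); split => /=.
  - by rewrite eqxx (subseq_trans pt).
  - by rewrite pM.
  - split=> // w wp wk.
    have wt := subseq_trans wp pt.
    apply: ht => //; first exact: take_subseq.
    by apply: size_takel; rewrite -wk size_subseq.
exists r => T s f /Hr - /(_ f) [p [ps pM hp]].
have [|c hc] := @pigeonhole_seq C N (map snd p); first by rewrite size_map pM.
pose q := map fst (filter (fun x => x.2 == c) p).
have hq : (N <= size q)%N.
  by rewrite size_map size_filter -(count_map snd (pred1 c)).
exists (take N q); split.
- apply: (subseq_trans (take_subseq _ _)); apply: subseq_trans ps.
  exact/map_subseq/filter_subseq.
- exact: size_takel.
- move=> u u' su su' zu zu'.
  by rewrite !(end_homogeneous_filter (c := c) hp) // ?(subseq_trans su)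
    ?(subseq_trans su') ?take_subseq.
Qed.

Lemma Ramsey_subseq_upto (C : finType) (d N : nat) : exists r : nat,
  forall (T : eqType) (s : seq T) (f : seq T -> C), (r <= size s)%N ->
  exists t, [/\ subseq t s, size t = N
    & forall k, (k < d)%N -> homogeneous k f t].
Proof.
elim: d N => [|d IHd] N.
  exists N => T s f hs; exists (take N s).
  by rewrite take_subseq size_takel.
have [r1 H1] := Ramsey_subseq C d N.
have [r2 H2] := IHd r1.
exists r2 => T s f /H2 - /(_ f) [t [ts tr ht]].
have [|t' [ts' tr' ht']] := H1 T t f; first by rewrite tr.
exists t'; split => // [|k]; first exact: subseq_trans ts.
rewrite ltnS leq_eqVlt => /predU1P[-> //|/ht]; exact: homogeneous_subseq.
Qed.

(** * Expansion of powers by exponent sequences, and its vanishing at the Thue-Morse signs *)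

(** Zero exponents are dropped, so that a variable absent from a monomial leaves no trace of its
    index. *)
Definition cons_pos (k : nat) (e : seq nat) : seq nat :=
  if k is 0 then e else k :: e.

Lemma cons_pos_cat k e e' : cons_pos k e ++ e' = cons_pos k (e ++ e').
Proof. by case: k. Qed.

Lemma size_le_sumn (e : seq nat) : 0%N \notin e -> (size e <= sumn e)%N.
Proof.
elim: e => //= x e IHe; rewrite in_cons negb_or => /andP[x0 /IHe]; lia.
Qed.

(** Both sides are the multinomial coefficient of [k], [m - k], [d - m]. *)
Lemma mul_bin_bin d m k : (k <= m)%N -> (m <= d)%N ->
  ('C(d, k) * 'C(d - k, m - k) = 'C(d, m) * 'C(m, k))%N.
Proof.
move=> km md; apply/eqP.
rewrite -(eqn_pmul2r (fact_gt0 k)) -(eqn_pmul2r (fact_gt0 (m - k))).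
rewrite -(eqn_pmul2r (fact_gt0 (d - m))); apply/eqP.
have h1 := bin_fact (leq_trans km md).
have h2 := bin_fact (leq_sub2r k md).
rewrite subnBA // (subnK (leq_trans km md)) in h2.
have h3 := bin_fact md; have h4 := bin_fact km.
transitivity (d`!)%N; [rewrite -h1 -h2 | rewrite -h3 -h4]; lia.
Qed.

Section PowerExpansion.
Context {R : realType}.
Implicit Types (ss : seq int) (lam : seq nat -> R).

(* The expansion of [(\sum_i s_i x_i) ^+ d] in which a monomial
   [x_{i_1} ^+ e_1 * ... * x_{i_m} ^+ e_m], with [i_1 < ... < i_m] and all
   [e_j > 0], is replaced by [lam [:: e_1; ...; e_m]]: only the exponents, not
   the indices, are remembered. *)
Fixpoint qexp (d : nat) ss lam : R :=
  if ss is s :: ss' then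
    \sum_(k < d.+1) ('C(d, k)%:Z * s ^+ k)%:~R
       * qexp (d - k) ss' (fun e => lam (cons_pos k e))
  else (d == 0%N)%:R * lam [::].

Lemma eq_qexp d ss lam lam' : lam =1 lam' -> qexp d ss lam = qexp d ss lam'.
Proof.
elim: ss d lam lam' => [|s ss IHs] d lam lam' h /=; first by rewrite h.
by apply: eq_bigr => k _; congr (_ * _); apply: IHs => e.
Qed.

Lemma qexp_0 d ss lam : (forall e, lam e = 0) -> qexp d ss lam = 0.
Proof.
elim: ss d lam => [|s ss IHs] d lam h /=; first by rewrite h mulr0.
by apply: big1 => k _; rewrite IHs ?mulr0.
Qed.

Lemma qexp0 ss lam : qexp 0 ss lam = lam [::].
Proof.
elim: ss lam => [|s ss IHs] lam /=; first by rewrite mul1r.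
by rewrite big_ord1 IHs expr0 bin0 !mul1r.
Qed.

Lemma qexp_opp d ss lam :
  qexp d (map -%R ss) lam = (-1) ^+ d * qexp d ss lam.
Proof.
elim: ss d lam => [|s ss IHs] d lam /=.
  by case: d => [|d]; rewrite ?mul1r //= !mul0r mulr0.
rewrite mulr_sumr; apply: eq_bigr => k _.
have hd : (-1) ^+ d = (-1) ^+ k * (-1) ^+ (d - k) :> R.
  by rewrite -exprD subnKC // -ltnS.
by rewrite IHs [(- s) ^+ _]exprNn hd !rmorphM !rmorphXn rmorphN1 /=; ring.
Qed.

Lemma triangular_sum (V : nmodType) d (F : nat -> nat -> V) :
  \sum_(k < d.+1) \sum_(j < (d - k).+1) F k j
  = \sum_(m < d.+1) \sum_(k < m.+1) F k (m - k)%N.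
Proof.
elim: d => [|d IHd]; first by rewrite !big_ord1.
rewrite [RHS]big_ord_recr -IHd /= big_ord_recr /= subnn big_ord1.
rewrite [X in _ = _ + X]big_ord_recr /= subnn addrA -big_split /=.
congr (_ + _).
apply: eq_bigr => k _.
by rewrite subSn ?big_ord_recr // -ltnS.
Qed.

(** This is the binomial theorem for the sum over [ss] plus the sum over [ss']. Indices in [ss]
    precede those in [ss'], so exponent sequences concatenate. *)
Lemma qexp_cat d ss ss' lam :
  qexp d (ss ++ ss') lam =
  \sum_(k < d.+1) 'C(d, k)%:R
    * qexp k ss (fun e => qexp (d - k) ss' (fun e' => lam (e ++ e'))).
Proof.
elim: ss d lam => [|s ss IHs] d lam.
  rewrite big_ord_recl /= big1 ?addr0 => [|i _]; last by rewrite mul0r mulr0.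
  by rewrite bin0 !mul1r subn0.
pose F k j : R := ('C(d, k)%:Z * s ^+ k)%:~R * ('C(d - k, j)%:R
  * qexp j ss (fun e => qexp (d - k - j) ss'
                          (fun e' => lam (cons_pos k (e ++ e'))))).
transitivity (\sum_(k < d.+1) \sum_(j < (d - k).+1) F k j).
  by rewrite /=; apply: eq_bigr => k _; rewrite IHs mulr_sumr.
(* Regroup by [m = k + j], the total degree in [s :: ss]. *)
rewrite triangular_sum /F.
apply: eq_bigr => m _ /=; rewrite mulr_sumr; apply: eq_bigr => k _.
have km : (k <= m)%N := ltn_ord k.
have md : (m <= d)%N := ltn_ord m.
have -> : (d - k - (m - k) = d - m)%N by rewrite -subnDA subnKC.
rewrite (@eq_qexp _ _ _ (fun e => qexp (d - m) ss'
  (fun e' => lam (cons_pos k e ++ e')))); last first.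
  by move=> e; apply: eq_qexp => e'; rewrite cons_pos_cat.
rewrite !mulrA; congr (_ * _).
have := congr1 (fun n => n%:R : R) (mul_bin_bin km md).
by rewrite /= !natrM !rmorphM /= -!pmulrn => h; rewrite mulrAC h; ring.
Qed.

(** The negated copy comes first because [delta] subtracts its first half; this is the usual
    sequence up to the global sign [(-1) ^ l]. *)
Fixpoint thue_morse (l : nat) : seq int :=
  if l is l'.+1 then map -%R (thue_morse l') ++ thue_morse l' else [:: 1].

Lemma size_thue_morse l : size (thue_morse l) = (2 ^ l)%N.
Proof.
by elim: l => //= l IHl; rewrite size_cat size_map IHl addnn expnS mul2n.
Qed.

Lemma norm_thue_morse l : all (fun s => `|s| == 1) (thue_morse l).
Proof.
elim: l => [|l IHl] /=; first by [].
rewrite all_cat IHl andbT all_map.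
by apply: sub_all IHl => s; rewrite /= normrN.
Qed.

(* Split the sign sequence into [- S] and [S], the exponent as [k + (d - k)].
   The terms [k = 0] and [k = d] cancel since [d] is odd; in every other term
   the odd one of [k], [d - k] is at most [d - 2], so that induction applies. *)
Lemma qexp_thue_morse l d lam :
  odd d -> (d < l.*2)%N -> qexp d (thue_morse l) lam = 0.
Proof.
elim: l d lam => [//|l IHl] d lam od dl /=.
rewrite qexp_cat.
case: d od dl => [//|d] od dl.
rewrite big_ord_recr big_ord_recl /= big1 => [|k _].
  rewrite qexp0 ?bin0 ?binn subnn ?subn0 !mul1r addr0.
  rewrite qexp_opp -signr_odd od expr1 mulN1r.
  apply/eqP; rewrite subr_eq0; apply/eqP/eq_qexp => e.
  by rewrite qexp0 cats0.
have kd := ltn_ord k.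
rewrite /bump /= add1n qexp_opp.
have [ok|ek] := boolP (odd k.+1).
  by rewrite IHl ?mulr0 //; move: od ok => /=; lia.
rewrite qexp_0 ?mulr0 // => e; apply: IHl.
  by rewrite oddB ?od ?(negbTE ek) //; lia.
by move: ek => /=; lia.
Qed.

(** * Approximation modulo 1 *)

Definition approx1 (x y del : R) : Prop :=
  exists m : int, `|x - y - m%:~R| <= del.

(** Integer coefficients carry integer shifts to integer shifts. *)
Lemma approx1_sum n (c : 'I_n -> int) (x y del : 'I_n -> R) :
  (forall i, approx1 (x i) (y i) (del i)) ->
  approx1 (\sum_i (c i)%:~R * x i) (\sum_i (c i)%:~R * y i)
          (\sum_i `|(c i)%:~R| * del i).
Proof.
move=> /fin_all_exists[m hm]; exists (\sum_i c i * m i).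
rewrite rmorph_sum -!sumrB.
apply: (le_trans (ler_norm_sum _ _ _)); apply: ler_sum => i _ /=.
by rewrite rmorphM -!mulrBr normrM ler_wpM2l.
Qed.

Definition monom (e : seq nat) (u : seq int) : R :=
  \prod_(z <- zip e u) z.2%:~R ^+ z.1.

Lemma monom_cons k e x u : monom (k :: e) (x :: u) = x%:~R ^+ k * monom e u.
Proof. by rewrite /monom /= big_cons. Qed.

Lemma approx1_power d ss (ns : seq int) (a : R) lam del :
  size ss = size ns -> all (fun s => `|s| == 1) ss ->
  (forall e u, subseq u ns -> size e = size u -> 0%N \notin e -> sumn e = d ->
     approx1 (a * monom e u) (lam e) del) ->
  approx1 (a * (\sum_(z <- zip ss ns) z.1%:~R * z.2%:~R) ^+ d)
          (qexp d ss lam) (del * (size ns)%:R ^+ d).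
Proof.
elim: ns ss d a lam => [|n ns IHn] [|s ss] //= d a lam; last first.
  move=> [sz] /andP[/eqP s1 hss] h.
  rewrite big_cons addrC exprDn mulr_sumr.
  set X := \sum_(z <- zip ss ns) _.
  (* The power of the first entry is absorbed into the coefficient [a], which therefore varies in
     the induction. *)
  have hk (k : 'I_d.+1) : approx1 (a * n%:~R ^+ k * X ^+ (d - k))
      (qexp (d - k) ss (fun e => lam (cons_pos k e)))
      (del * (size ns)%:R ^+ (d - k)).
    have kd : (k <= d)%N := ltn_ord k.
    apply: IHn => // e u su eu pe se.
    move: kd se; case: (nat_of_ord k) => [|k'] kd se /=.
      rewrite expr0 mulr1; apply: h => //; last by rewrite se subn0.
      exact: subseq_trans su (subseq_cons _ _).
    rewrite -mulrA -monom_cons; apply: h => /=.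
    - by rewrite eqxx.
    - by rewrite eu.
    - by rewrite in_cons negb_or.
    - by rewrite se subnKC.
  have := approx1_sum (fun k : 'I_d.+1 => ('C(d, k)%:Z * s ^+ k)) hk.
  congr (approx1 _ _ _).
    apply: eq_bigr => k _.
    by rewrite -mulr_natl exprMn !rmorphM !rmorphXn /= -pmulrn; ring.
  rewrite -natr1 exprDn mulr_sumr; apply: eq_bigr => k _.
  rewrite -intr_norm normrM normrX s1 expr1n mulr1 ger0_norm // expr1n mulr1.
  by rewrite -pmulrn -mulr_natl; ring.
move=> _ _ h; rewrite big_nil.
case: d h => [|d] h; last first.
  by exists 0; rewrite !expr0n /= !mulr0 mul0r !subr0 normr0.
by rewrite !expr0 mul1r !mulr1; have := h [::] [::] isT erefl isT erefl;
  rewrite /monom big_nil mulr1.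
Qed.

Lemma delta_thue_morse l (m : seq int) : size m = (2 ^ l)%N ->
  (delta l m)%:~R = \sum_(z <- zip (thue_morse l) m) z.1%:~R * z.2%:~R :> R.
Proof.
elim: l m => [|l IHl] m hm.
  by case: m hm => [|x []] //= _; rewrite big_seq1 mul1r.
have ht : size (take (2 ^ l) m) = (2 ^ l)%N.
  by apply: size_takel; rewrite hm leq_exp2l.
have hd : size (drop (2 ^ l) m) = (2 ^ l)%N.
  by rewrite size_drop hm expnS mul2n -addnn addnK.
rewrite /= rmorphB /= (IHl _ hd) (IHl _ ht).
rewrite -{3}(cat_take_drop (2 ^ l) m) zip_cat ?size_map ?size_thue_morse //.
rewrite big_cat /= addrC; congr (_ + _).
have zipN (s t : seq int) :
    zip (map -%R s) t = map (fun z => (- z.1, z.2)) (zip s t).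
  by elim: s t => [|x s IHs] [|y t] //=; rewrite IHs.
rewrite zipN big_map -sumrN.
by apply: eq_bigr => z _ /=; rewrite rmorphN mulNr.
Qed.

(** * Colouring by monomials modulo 1 *)

(** The index of the one among [M.+1] equal subintervals of [[0, 1)] that contains the fractional
    part; [inord] never meets its default. *)
Definition frac_color (M : nat) (x : R) : 'I_M.+1 :=
  inord (Num.truncn (M.+1%:R * (x - (Num.floor x)%:~R))).

Lemma approx1_frac_color M (x y : R) :
  frac_color M x = frac_color M y -> approx1 x y M.+1%:R^-1.
Proof.
move=> hxy; exists (Num.floor x - Num.floor y).
have M0 : 0 < M.+1%:R :> R by rewrite ltr0n.
have frac_itv (z : R) : 0 <= M.+1%:R * (z - (Num.floor z)%:~R) < M.+1%:R.
  have /andP[z0 z1] := floor_itv z.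
  rewrite rmorphD /= in z1.
  by rewrite mulr_ge0 ?subr_ge0 ?(ltW M0) //= gtr_pMr // ltrBlDl.
have trunc_color (z : R) :
    (frac_color M z : nat) = Num.truncn (M.+1%:R * (z - (Num.floor z)%:~R)).
  rewrite inordK // -(ltr_nat R).
  have /andP[z0 z1] := frac_itv z.
  by have /andP[h _] := truncn_itv z0; apply: le_lt_trans z1.
have /andP[x0 _] := frac_itv x; have /andP[y0 _] := frac_itv y.
have := truncn_itv x0; have := truncn_itv y0.
rewrite -!trunc_color -hxy.
move: (frac_color M x) => c; rewrite -[c.+1%:R]natr1.
move=> /andP[h1 h2] /andP[h3 h4].
rewrite -(ler_pM2l M0) mulfV ?gt_eqF // -{1}[M.+1%:R]gtr0_norm // -normrM.
rewrite ler_norml rmorphB /=.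
by apply/andP; split; lra.
Qed.

Lemma dist_int_le (x del : R) : approx1 x 0 del -> dist_int x <= del.
Proof.
move=> [m hm]; rewrite subr0 in hm; apply: le_trans hm.
apply: ge_inf; last by exists m.
by exists 0 => _ [k _ <-].
Qed.

(** One colour records all coefficients and exponent sequences together. Bounding lengths and
    entries keeps the colour type finite, yet admits every sequence of positive exponents with sum
    below [l.*2]. *)
Definition monom_colors (l M : nat) (a : nat -> R) (u : seq int) :
    {ffun 'I_l.+1 * l.*2.-bseq 'I_l.*2 -> 'I_M.+1} :=
  [ffun je : 'I_l.+1 * l.*2.-bseq 'I_l.*2 =>
     frac_color M (a je.1 * monom (map val je.2) u)].

Lemma approx1_monom l M (a : nat -> R) j e u u' :
  (j <= l)%N -> 0%N \notin e -> (sumn e < l.*2)%N ->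
  monom_colors l M a u = monom_colors l M a u' ->
  approx1 (a j * monom e u) (a j * monom e u') M.+1%:R^-1.
Proof.
move=> jl e0 sume /ffunP hc; apply: approx1_frac_color.
have l0 : (0 < l.*2)%N by apply: leq_ltn_trans sume.
have le_e : all (fun k => k < l.*2)%N e.
  apply/allP => k ke; apply: leq_ltn_trans sume.
  by rewrite (perm_sumn (perm_to_rem ke)) /= leq_addr.
pose e' := map (insubd (Ordinal l0)) e.
have he' : (size e' <= l.*2)%N.
  by rewrite size_map ltnW // (leq_ltn_trans (size_le_sumn e0)).
have ee' : map val e' = e.
  rewrite -map_comp -[RHS]map_id; apply/eq_in_map => k /(allP le_e) hk.
  by rewrite /= val_insubd hk.
by have := hc (Ordinal (jl : (j < l.+1)%N), Bseq he'); rewrite !ffunE /= ee'.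
Qed.

Lemma approx1_thue_morse l M (a : nat -> R) j (t : seq int) :
  size t = (2 ^ l)%N -> (0 < j <= l)%N ->
  (forall k, (k < l.*2)%N -> homogeneous k (monom_colors l M a) t) ->
  approx1 (a j * (delta l t)%:~R ^+ (2 * j - 1)) 0
          (M.+1%:R^-1 * (2 ^ l)%:R ^+ (2 * j - 1)).
Proof.
move=> st /andP[j0 jl] ht; rewrite delta_thue_morse // -st.
have d_lt : (2 * j - 1 < l.*2)%N by lia.
(* By homogeneity, the first [size e] entries of [t] can represent all subsequences of that length.
   The target 0 is then rewritten as the vanishing expansion at this [lam]. *)
pose lam e := a j * monom e (take (size e) t).
rewrite -[X in approx1 _ X](@qexp_thue_morse l (2 * j - 1) lam) //; last by lia.
apply: approx1_power => [||e u ut eu e0 se].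
- by rewrite size_thue_morse.
- exact: norm_thue_morse.
apply: (approx1_monom (l := l)) => //; first by rewrite se.
apply: (ht (size e)) => //.
- by rewrite (leq_ltn_trans (size_le_sumn e0)) ?se.
- exact: take_subseq.
- by apply: size_takel; rewrite eu size_subseq.
Qed.

End PowerExpansion.

(** The mask that cuts [t] out of [n] also cuts the required increasing indices out of the
    enumeration of ['I_r]. *)
Lemma subseq_Dset l r (n : r.-tuple int) (t : seq int) :
  subseq t n -> size t = (2 ^ l)%N -> Dset l n (delta l t).
Proof.
move=> /subseqP[m sm ->] st.
have hj : size (mask m (enum 'I_r)) == (2 ^ l)%N.
  by rewrite -st !size_mask // ?size_enum_ord ?sm ?size_tuple.
exists (Tuple hj); split => /=.
  rewrite map_mask val_enum_ord; apply: sorted_mask; first exact: ltn_trans.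
  exact: iota_ltn_sorted.
by rewrite map_mask map_tnth_enum.
Qed.

Theorem theorem3p8 (R : realType) (l : nat) (hl : (1 <= l)%N)
    (eps : R) (heps : 0 < eps) :
  exists r : nat, (2 ^ l <= r)%N /\
    forall a : nat -> R,
      is_Delta_star l r
        (return_set (\sum_(1 <= j < l.+1) a j *: 'X^(2 * j - 1)) eps).
Proof.
(* The total error over all odd degrees is [K / M.+1]. Both [K] and [M] depend only on [l] and
   [eps], so [r] is uniform in the coefficients [a]. *)
pose K : R := \sum_(j < l) (2 ^ l)%:R ^+ (2 * j.+1 - 1).
pose M := Num.truncn (K / eps).
have hM : M.+1%:R^-1 * K < eps.
  by rewrite mulrC ltr_pdivrMr ?ltr0n // -ltr_pdivrMl // mulrC truncnS_gt.
have [r Hr] := Ramsey_subseq_upto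
  {ffun 'I_l.+1 * l.*2.-bseq 'I_l.*2 -> 'I_M.+1} l.*2 (2 ^ l).
exists (maxn r (2 ^ l)); split=> [|a]; first exact: leq_maxr.
split=> [n [] //|F [Fpos [n nF]]].
have [|t [tn st ht]] := Hr _ (val n) (monom_colors l M a).
  by rewrite size_tuple leq_maxl.
have Ft : F (delta l t) by apply: nF; exact: subseq_Dset.
exists (delta l t); split=> //; split; first exact: Fpos.
apply: le_lt_trans hM; apply: dist_int_le.
rewrite big_add1 big_mkord horner_sum.
under eq_bigr do rewrite hornerZ hornerXn.
have hj (j : 'I_l) : approx1 (a j.+1 * (delta l t)%:~R ^+ (2 * j.+1 - 1)) 0
    (M.+1%:R^-1 * (2 ^ l)%:R ^+ (2 * j.+1 - 1)).
  by apply: approx1_thue_morse => //=.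
have := approx1_sum (fun _ => 1) hj.
rewrite mulr_sumr; congr (approx1 _ _ _).
- by apply: eq_bigr => j _; rewrite mul1r.
- by apply: big1 => j _; rewrite mulr0.
- by apply: eq_bigr => j _; rewrite normr1 mul1r.
Qed.
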